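(* Let $\mathcal{D}$ be a probability distribution over prompts $x$, let $\mathcal{Y}$ be a finite or countable set of responses, let $\pi_{\mathrm{inst}}(\cdot\mid x)$ be a reference policy, $r(x,y)\in\mathbb{R}$ a reward function, and $\beta>0$. For a policy $\pi$ define $$\mathcal{J}(\pi)=\mathbb{E}_{x\sim\mathcal{D}}\Big[\mathbb{E}_{y\sim\pi(\cdot\mid x)}[r(x,y)]-\beta\,\mathrm{KL}\big(\pi(\cdot\mid x)\,\|\,\pi_{\mathrm{inst}}(\cdot\mid x)\big)\Big],$$ and let $$\pi_{\mathrm{reas}}(y\mid x)=\frac{1}{Z(x)}\,\pi_{\mathrm{inst}}(y\mid x)\exp\Big(\frac1\beta r(x,y)\Big),\qquad Z(x)=\sum_{y\in\mathcal{Y}}\pi_{\mathrm{inst}}(y\mid x)\exp\Big(\frac1\beta r(x,y)\Big).$$ Then for every policy $\pi$ (for which all the expectations and divergences involved, for $\pi$ and for $\pi_{\mathrm{reas}}$, are well-defined and finite), $$\mathcal{J}(\pi_{\mathrm{reas}})-\mathcal{J}(\pi)=\beta\,\mathbb{E}_{x\sim\mathcal{D}}\Big[\mathrm{KL}\big(\pi(\cdot\mid x)\,\|\,\pi_{\mathrm{reas}}(\cdot\mid x)\big)\Big].$$ In particular, maximizing $\mathcal{J}(\pi)$ over such policies is equivalent to minimizing $\mathbb{E}_{x\sim\mathcal{D}}[\mathrm{KL}(\pi(\cdot\mid x)\|\pi_{\mathrm{reas}}(\cdot\mid x))]$.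
   Context: A policy $\pi$ assigns to each prompt $x$ a probability distribution $\pi(\cdot\mid x)$ on $\mathcal{Y}$. $\mathrm{KL}(P\|Q)=\sum_y P(y)\log\frac{P(y)}{Q(y)}$, with the convention $0\log 0=0$, and value $+\infty$ if $P$ is not absolutely continuous with respect to $Q$. *)

(* Defs.v *)
(* MathComp-Analysis *)
From HB Require Import structures.
From mathcomp Require Import all_boot all_order all_algebra.
From mathcomp Require Import all_classical all_reals all_analysis.

Set Implicit Arguments.
Unset Strict Implicit.
Unset Printing Implicit Defensive.
Import Order.TTheory GRing.Theory Num.Theory.
Import numFieldNormedType.Exports.

Local Open Scope classical_set_scope.
Local Open Scope ring_scope.
Local Open Scope ereal_scope.

(* The library's esum is meant for nonnegative families, hence the split into
   positive and negative parts, as for the Lebesgue integral. Since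
   +oo - +oo = -oo in \bar R, [csum f] is a finite number exactly when f is
   absolutely summable. *)
Definition csum (R : realType) (Y : countType) (f : Y -> R) : \bar R :=
  \esum_(y in [set: Y]) (EFin \o f)^\+ y -
  \esum_(y in [set: Y]) (EFin \o f)^\- y.

Definition is_pmf (R : realType) (Y : countType) (p : Y -> R) : Prop :=
  (forall y, (0 <= p y)%R) /\ \esum_(y in [set: Y]) (p y)%:E = 1.

Definition is_policy (R : realType) (X : Type) (Y : countType)
  (p : X -> Y -> R) : Prop := forall x, is_pmf (p x).

Definition mean (R : realType) (Y : countType) (p f : Y -> R) : \bar R :=
  csum (fun y => p y * f y)%R.

Definition abs_cont (R : realType) (Y : countType) (p q : Y -> R) : Prop :=
  forall y, q y = 0%R -> p y = 0%R.

Definition KL (R : realType) (Y : countType) (p q : Y -> R) : \bar R :=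
  if `[< abs_cont p q >] then csum (fun y => p y * ln (p y / q y))%R else +oo.

Definition Zpart (R : realType) (X : Type) (Y : countType)
  (pinst r : X -> Y -> R) (beta : R) (x : X) : \bar R :=
  \esum_(y in [set: Y]) (pinst x y * expR (beta^-1 * r x y))%:E.

(* Meaningful only where [Zpart] is finite. *)
Definition preas (R : realType) (X : Type) (Y : countType)
  (pinst r : X -> Y -> R) (beta : R) (x : X) (y : Y) : R :=
  ((fine (Zpart pinst r beta x))^-1 *
   (pinst x y * expR (beta^-1 * r x y)))%R.

Definition Jinner (R : realType) (X : Type) (Y : countType)
  (pinst r : X -> Y -> R) (beta : R) (p : X -> Y -> R) (x : X) : \bar R :=
  mean (p x) (r x) - beta%:E * KL (p x) (pinst x).

Definition J (R : realType) (d : measure_display) (X : measurableType d)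
  (D : probability X R) (Y : countType) (pinst r : X -> Y -> R) (beta : R)
  (p : X -> Y -> R) : \bar R :=
  \int[D]_x Jinner pinst r beta p x.

Definition EKL (R : realType) (d : measure_display) (X : measurableType d)
  (D : probability X R) (Y : countType) (p q : X -> Y -> R) : \bar R :=
  \int[D]_x KL (p x) (q x).

(* All the expectations and divergences occurring in [J] and [EKL] at the
   policy [p] are well-defined and finite; those depending on a prompt are
   only required to be so for almost every prompt. *)
Definition finite_terms (R : realType) (d : measure_display)
  (X : measurableType d) (D : probability X R) (Y : countType)
  (pinst r : X -> Y -> R) (beta : R) (p : X -> Y -> R) : Prop :=
  [/\ {ae D, forall x, mean (p x) (r x) \is a fin_num},
      {ae D, forall x, KL (p x) (pinst x) \is a fin_num},
      {ae D, forall x, KL (p x) (preas pinst r beta x) \is a fin_num},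
      D.-integrable [set: X] (Jinner pinst r beta p) &
      D.-integrable [set: X] (fun x => KL (p x) (preas pinst r beta x))].

(* Main.v *)
(** Substituting ln preas = ln pinst + r / beta - ln Z into KL (p || preas)
    gives, prompt by prompt, Jinner p + beta KL (p || preas) = beta ln Z, which
    does not depend on p. Comparing p with preas, whose divergence from itself
    is 0, and integrating over the prompts yields the identity. *)
Require Import Defs.
From HB Require Import structures.
From mathcomp Require Import all_boot all_order all_algebra.
From mathcomp Require Import all_classical all_reals all_analysis.
From mathcomp Require Import ring.
Import Order.TTheory GRing.Theory Num.Theory.
Local Open Scope classical_set_scope.
Local Open Scope ring_scope.
Local Open Scope ereal_scope.

(** Scaling commutes with the finite partial sums, so passing to suprema gives [<=] for every
    nonnegative factor. The same bound for the factor [c^-1] gives the converse, which is why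
    [c = 0] is treated apart. *)
Lemma ge0_esumZl (R : realType) (T : choiceType) (A : set T) (c : R)
  (f : T -> \bar R) : (0 <= c)%R -> (forall i, 0 <= f i) ->
  \esum_(i in A) (c%:E * f i) = c%:E * \esum_(i in A) f i.
Proof.
move=> c0 f0.
have le (b : R) (g : T -> \bar R) : (0 <= b)%R -> (forall i, 0 <= g i) ->
    \esum_(i in A) (b%:E * g i) <= b%:E * \esum_(i in A) g i.
  move=> b0 g0; apply: ge_ereal_sup => _ [B [finB BA] <-].
  by rewrite -ge0_mule_fsumr// lee_wpmul2l ?lee_fin// esum_ge//; exists B.
have [->|cn0] := eqVneq c 0%R.
  by rewrite mul0e esum1// => i _; rewrite mul0e.
apply/eqP; rewrite eq_le le//=.
have -> : \esum_(i in A) f i = \esum_(i in A) (c^-1%:E * (c%:E * f i)).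
  by apply: eq_esum => i _; rewrite muleA -EFinM mulVf// mul1e.
have cV0 : (0 <= c^-1)%R by rewrite invr_ge0.
have H : \esum_(i in A) (c^-1%:E * (c%:E * f i)) <=
    c^-1%:E * \esum_(i in A) (c%:E * f i).
  by apply: le => // i; rewrite mule_ge0.
apply: (le_trans (lee_wpmul2l _ H)); first by rewrite lee_fin.
by rewrite muleA -EFinM divff// mul1e.
Qed.

Section csum_lemmas.
Variables (R : realType) (Y : countType).
Implicit Types f g : Y -> R.

Lemma csum_fin_numP f : csum f \is a fin_num ->
  (\esum_(y in [set: Y]) (EFin \o f)^\+ y \is a fin_num) /\
  (\esum_(y in [set: Y]) (EFin \o f)^\- y \is a fin_num).
Proof. by rewrite /csum fin_numB => /andP[]. Qed.

(** Positive parts are not additive, but [f + g] is still the difference of [f^+ + g^+] and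
    [f^- + g^-]. Both are nonnegative and summable, and [esumB] allows any such decomposition in
    place of the canonical one. *)
Lemma csumD f g : csum f \is a fin_num -> csum g \is a fin_num ->
  csum (fun y => f y + g y)%R = csum f + csum g.
Proof.
move=> /csum_fin_numP[fp fn] /csum_fin_numP[gp gn].
pose h1 := (EFin \o f)^\+ \+ (EFin \o g)^\+.
pose h2 := (EFin \o f)^\- \+ (EFin \o g)^\-.
have h10 y : 0 <= h1 y by rewrite adde_ge0.
have h20 y : 0 <= h2 y by rewrite adde_ge0.
have E1 : esum [set: Y] h1 =
    esum [set: Y] (EFin \o f)^\+ + esum [set: Y] (EFin \o g)^\+.
  by rewrite esumD.
have E2 : esum [set: Y] h2 =
    esum [set: Y] (EFin \o f)^\- + esum [set: Y] (EFin \o g)^\-.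
  by rewrite esumD.
have Sh (h : Y -> \bar R) : (forall y, 0 <= h y) ->
    esum [set: Y] h \is a fin_num -> summable [set: Y] h.
  move=> h0 hfin; rewrite summableE (_ : esum _ _ = esum [set: Y] h)//.
  by apply: eq_esum => y _; rewrite gee0_abs.
have hE : EFin \o (fun y => f y + g y)%R = h1 \- h2.
  exact: (funeD_posD (EFin \o f) (EFin \o g)).
rewrite /csum hE esumB//; last 2 first.
  by apply: Sh => //; rewrite E1 fin_numD fp gp.
  by apply: Sh => //; rewrite E2 fin_numD fn gn.
by rewrite E1 E2 oppeD ?fin_num_adde_defl// addeACA.
Qed.

Lemma csumN f : csum f \is a fin_num -> csum (fun y => - f y)%R = - csum f.
Proof.
move=> /csum_fin_numP[fp fn].
rewrite /csum (_ : EFin \o (fun y => - f y)%R = \- (EFin \o f))//.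
by rewrite funeposN funenegN oppeB ?fin_num_adde_defr// addeC.
Qed.

Lemma csumZl (c : R) f : csum f \is a fin_num ->
  csum (fun y => c * f y)%R = c%:E * csum f.
Proof.
(* A nonnegative factor commutes with positive and negative parts; a negative one swaps them, and is
   handled by [csumN]. *)
have Zpos (b : R) g : (0 <= b)%R -> csum g \is a fin_num ->
    csum (fun y => b * g y)%R = b%:E * csum g.
  move=> b0 /csum_fin_numP[gp gn].
  rewrite /csum (_ : EFin \o _ = (fun y => b%:E * (EFin \o g) y))//.
  by rewrite ge0_funeposM// ge0_funenegM// !ge0_esumZl//
    muleBr// fin_num_adde_defr.
move=> ffin; have [c0|c0] := leP 0%R c; first exact: Zpos.
have -> : (fun y => c * f y)%R = (fun y => - ((- c) * f y))%R.
  by apply/funext => y; ring.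
rewrite csumN Zpos ?oppr_ge0 1?ltW//; last by rewrite fin_numM.
by rewrite EFinN mulNe oppeK.
Qed.

Lemma csum_ge0 f : (forall y, 0 <= f y)%R ->
  csum f = \esum_(y in [set: Y]) (f y)%:E.
Proof.
move=> f0; rewrite /csum [X in _ - X]esum1 ?sube0.
  apply: eq_esum => y _.
  by rewrite (@ge0_funeposE _ _ setT) ?inE// => z _; rewrite lee_fin.
by move=> y _; rewrite (@ge0_funenegE _ _ setT) ?inE// => z _; rewrite lee_fin.
Qed.

End csum_lemmas.
Lemma KL_fin_num (R : realType) (Y : countType) (p1 p2 : Y -> R) :
  KL p1 p2 \is a fin_num ->
  abs_cont p1 p2 /\ KL p1 p2 = csum (fun y => p1 y * ln (p1 y / p2 y))%R.
Proof. by rewrite /KL; case: asboolP. Qed.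

Lemma KL_self (R : realType) (Y : countType) (p : Y -> R) : KL p p = 0.
Proof.
have term0 y : (p y * ln (p y / p y))%R = 0%R.
  (* Where [p y = 0], the factor [p y] absorbs the junk value of [ln (0 / 0)]. *)
  by have [->|p0] := eqVneq (p y) 0%R; rewrite ?mul0r// divff// ln1 mulr0.
rewrite /KL asboolT// csum_ge0 => [|y]; last by rewrite term0.
by rewrite esum1// => y _; rewrite term0.
Qed.

Section gibbs_policy.
Variables (R : realType) (X : Type) (Y : countType).
Variables (pinst r : X -> Y -> R) (beta : R) (x : X).
Hypotheses (hinst : is_pmf (pinst x)) (hbeta : (0 < beta)%R).
Hypothesis hZ : Zpart pinst r beta x < +oo.

Let weight y : R := (pinst x y * expR (beta^-1 * r x y))%R.
Let Z : R := fine (Zpart pinst r beta x).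
Let q := preas pinst r beta x.

Let weight_ge0 y : (0 <= weight y)%R.
Proof. by rewrite mulr_ge0 ?expR_ge0//; apply: hinst.1. Qed.

Let ZE : Zpart pinst r beta x = Z%:E.
Proof.
rewrite /Z fineK// ge0_fin_numE//; apply: esum_ge0 => y _.
by rewrite lee_fin weight_ge0.
Qed.

(** Each weight is at most the partition sum. If that sum were zero, all weights would vanish, and
    the exponential being positive, so would [pinst x], contradicting its total mass 1. *)
Let Z_gt0 : (0 < Z)%R.
Proof.
rewrite lt_neqAle eq_sym -lee_fin -ZE.
apply/andP; split; last by apply: esum_ge0 => y _; rewrite lee_fin weight_ge0.
apply/eqP => Z0; have := hinst.2; rewrite esum1.
  by move/eqP; rewrite eq_sym onee_eq0.
move=> y _; congr EFin; apply/eqP.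
have : (weight y)%:E <= Zpart pinst r beta x.
  apply: esum_ge; exists [set y]; first by split.
  by rewrite fsbig_set1.
rewrite ZE Z0 lee_fin => w0.
have : weight y == 0%R by rewrite eq_le w0 weight_ge0.
by rewrite mulf_eq0 (gt_eqF (expR_gt0 _)) orbF => /eqP ->.
Qed.

Lemma preas_pmf : is_pmf q.
Proof.
split=> [y|]; first by rewrite mulr_ge0 ?invr_ge0 ?(ltW Z_gt0)// weight_ge0.
rewrite (_ : esum _ _ = \esum_(y in [set: Y]) (Z^-1%:E * (weight y)%:E)).
  rewrite ge0_esumZl ?invr_ge0 ?(ltW Z_gt0)//.
  by rewrite -/(Zpart pinst r beta x) ZE -EFinM mulVf// gt_eqF.
by apply: eq_esum.
Qed.

Lemma Jinner_KL (p : X -> Y -> R) : is_pmf (p x) ->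
  mean (p x) (r x) \is a fin_num -> KL (p x) (pinst x) \is a fin_num ->
  KL (p x) q \is a fin_num ->
  Jinner pinst r beta p x + beta%:E * KL (p x) q = (beta * ln Z)%:E.
Proof.
move=> [p0 p1] meanfin Kfin Kqfin.
have psum : csum (p x) = 1 by rewrite csum_ge0.
have pfin : csum (p x) \is a fin_num by rewrite psum.
have [pac KE] := KL_fin_num _ _ _ _ Kfin.
have [_ KqE] := KL_fin_num _ _ _ _ Kqfin.
(* The logarithmic identity is arranged with additions only, so that both sides split by [csumD]
   into finite sums. *)
have : csum (fun y => p x y * ln (p x y / q y) + beta^-1 * (p x y * r x y))%R =
       csum (fun y => p x y * ln (p x y / pinst x y) + ln Z * p x y)%R.
  congr csum; apply/funext => y.
  (* Outside the support of [p x] both sides are zero; on it, absolute continuity makes [pinst x y]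
     positive, so the logarithm of the product splits. *)
  have [->|py0] := eqVneq (p x y) 0%R; first by rewrite !mul0r !mulr0.
  have pgt0 : (0 < p x y)%R by rewrite lt_neqAle eq_sym py0 p0.
  have ipos : (0 < pinst x y)%R.
    rewrite lt_neqAle eq_sym hinst.1 andbT.
    by apply/eqP => /pac/eqP; rewrite (negbTE py0).
  have -> : (p x y / q y =
      (p x y / pinst x y) * (Z * expR (- (beta^-1 * r x y))))%R.
    rewrite expRN /q /preas -/Z.
    have := expR_gt0 (beta^-1 * r x y); move: (expR _) => e e0.
    by field; rewrite !gt_eqF.
  rewrite !lnM ?posrE ?mulr_gt0 ?invr_gt0 ?expR_gt0// expRK; ring.
rewrite csumD -?KqE//; last by rewrite csumZl// fin_numM.
rewrite csumD -?KE//; last by rewrite csumZl// fin_numM.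
rewrite !csumZl// -/(mean (p x) (r x)) psum mule1 /Jinner.
(* All three quantities are finite, so the rest is real arithmetic: solve for [ln Z] and multiply by
   [beta]. *)
move: meanfin Kfin Kqfin => /fineK <- /fineK <- /fineK <-.
rewrite -!EFinM -!EFinD => -[] E; congr EFin.
have b0 : beta != 0%R by rewrite gt_eqF.
have -> : ln Z = (fine (KL (p x) q) + beta^-1 * fine (mean (p x) (r x))
   - fine (KL (p x) (pinst x)))%R by rewrite E; ring.
by field.
Qed.

End gibbs_policy.

Section J_EKL.
Variables (R : realType) (d : measure_display) (X : measurableType d).
Variables (D : probability X R) (Y : countType).
Variables (pinst r : X -> Y -> R) (beta : R).
Hypotheses (hinst : is_policy pinst) (hbeta : (0 < beta)%R).
Hypothesis hZ : forall x, Zpart pinst r beta x < +oo.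
Local Notation q := (preas pinst r beta).
Hypothesis hreas : finite_terms D pinst r beta q.

Lemma J_fin_num p : finite_terms D pinst r beta p ->
  J D pinst r beta p \is a fin_num.
Proof. by case=> _ _ _ ? _; exact: integrable_fin_num. Qed.

Lemma J_preas p : is_policy p -> finite_terms D pinst r beta p ->
  J D pinst r beta q = J D pinst r beta p + beta%:E * EKL D p q.
Proof.
move=> hp [mp kp kqp Jp Ep]; case: hreas => mq kq kqq Jq _.
have bE : D.-integrable [set: X] (fun x => beta%:E * KL (p x) (q x)).
  exact: integrableZl.
(* Integrability merges the right-hand side into a single integral; the integrands then need to
   agree only for almost every prompt, where the terms are finite. *)
rewrite /J /EKL -integralZl// -integralD//.
apply: ae_eq_integral => //.
- exact: measurable_int Jq.
- by apply: emeasurable_funD; [exact: measurable_int Jp|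
    exact: measurable_int bE].
have hq : is_policy q by move=> x; exact: preas_pmf.
near=> x => _.
rewrite Jinner_KL//; try by near: x.
(* The constant [beta * ln Z] obtained from [p] is read back as the same identity at the Gibbs
   policy itself. *)
rewrite -(Jinner_KL _ _ _ _ r _ _ (hinst x) hbeta (hZ x) _ (hq x));
  try by near: x.
by rewrite KL_self mule0 adde0.
Unshelve. all: by end_near. Qed.

End J_EKL.

Theorem mainTheorem6 (R : realType) (d : measure_display)
  (X : measurableType d) (D : probability X R) (Y : countType)
  (pinst r : X -> Y -> R) (beta : R)
  (hinst : is_policy pinst) (hbeta : (0 < beta)%R)
  (hZ : forall x, Zpart pinst r beta x < +oo)
  (hreas : finite_terms D pinst r beta (preas pinst r beta)) :
  (forall p : X -> Y -> R,
     is_policy p -> finite_terms D pinst r beta p ->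
     J D pinst r beta (preas pinst r beta) - J D pinst r beta p =
     beta%:E * EKL D p (preas pinst r beta)) /\
  (forall p : X -> Y -> R,
     is_policy p -> finite_terms D pinst r beta p ->
     ((forall q : X -> Y -> R,
         is_policy q -> finite_terms D pinst r beta q ->
         J D pinst r beta q <= J D pinst r beta p) <->
      (forall q : X -> Y -> R,
         is_policy q -> finite_terms D pinst r beta q ->
         EKL D p (preas pinst r beta) <= EKL D q (preas pinst r beta)))).
Proof.
have JE p (hp : is_policy p) (fp : finite_terms D pinst r beta p) :
    J D pinst r beta (preas pinst r beta) - J D pinst r beta p =
    beta%:E * EKL D p (preas pinst r beta).
  rewrite (J_preas _ _ _ _ _ _ _ _ hinst hbeta hZ hreas _ hp fp).
  by rewrite addeAC subee ?add0e// J_fin_num.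
split=> // p hp fp.
(* Subtracting from the common finite value [J] at [preas] reverses the order, and [beta > 0]
   cancels. The equivalence thus holds competitor by competitor. *)
have leE q : is_policy q -> finite_terms D pinst r beta q ->
    (J D pinst r beta q <= J D pinst r beta p) =
    (EKL D p (preas pinst r beta) <= EKL D q (preas pinst r beta)).
  move=> hq fq.
  rewrite -[RHS](@lee_pmul2l _ beta%:E)// -!JE//.
  by rewrite leeD2lE ?J_fin_num// leeN2.
by split=> H q hq fq; have := H q hq fq; rewrite leE.
Qed.
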